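(* For $\alpha,\beta>-1$ let $\{\phi_i\}_{i\in\mathbb N}$ be the orthonormal Jacobi polynomial basis, $T=\{t_n\}_{n=1}^N\subseteq[-1,1]$ a set of scattered points with density $h$. Then for each $0<\epsilon<1$ there exists $c(\epsilon)>0$ such that if $h\le c(\epsilon)M^{-2}$, then the least-squares problem $\min_{z\in\mathbb C^M}\|UP_Mz-y\|$ has a unique solution $\check x$, and it satisfies $$\|x-\check x\|\le\left(1+\frac1{\sqrt{1-\epsilon}}\right)\|x-P_Mx\|_{1,w}+\frac1{\sqrt{1-\epsilon}}\eta$$ for any weights $w=\{w_i\}_{i\in\mathbb N}$ with $w_i\ge\|\phi_i\|_{L^\infty}$.
   Context: Jacobi setting: $D=(-1,1)$, $\nu(t)=c^{(\alpha,\beta)}(1-t)^\alpha(1+t)^\beta$ normalized so $\int\nu=1$; $\phi_j$ is the degree-$(j-1)$ Jacobi polynomial $P^{(\alpha,\beta)}_{j-1}$ rescaled so $\{\phi_j\}$ is orthonormal in $L^2_\nu$. Density $h=\sup_{t\in(-1,1)}\min_n|t-t_n|$; Voronoi cells $V_n=\{t\in(-1,1):|t-t_n|\le|t-t_m|\ \forall m\ne n\}$; quadrature weights $\tau_n=\int_{V_n}\nu$. $U$ is the $N\times\infty$ matrix $U_{n,i}=\sqrt{\tau_n}\phi_i(t_n)$; $P_M$ the projection onto the first $M$ coordinates ($\mathbb C^M$ identified with sequences supported there). Target $f=\sum_ix_i\phi_i$ with coefficient sequence $x$; data $y=\{\sqrt{\tau_n}(f(t_n)+e_n)\}$, $|e_n|\le\eta$.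 $\|z\|_{1,w}=\sum_iw_i|z_i|$, $\|\cdot\|$ the $\ell^2$ norm. *)

(* Defs.v *)
From HB Require Import structures.
From mathcomp Require Import all_boot all_order all_algebra.
From mathcomp Require Import all_classical all_reals.
From mathcomp Require Import topology normedtype sequences measure lebesgue_measure
  lebesgue_integral exp.
From mathcomp Require Import complex.
Set Implicit Arguments. Unset Strict Implicit. Unset Printing Implicit Defensive.
Import Order.TTheory GRing.Theory Num.Theory numFieldNormedType.Exports.
Local Open Scope classical_set_scope.
Local Open Scope ring_scope.

Section JacobiDefs.
Variable R : realType.

Definition cmod (z : R[i]) : R :=
  Num.sqrt (complex.Re z ^+ 2 + complex.Im z ^+ 2).

Definition jacobi_w (alpha beta : R) (s : R) : R :=
  (1 - s) `^ alpha * (1 + s) `^ beta.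

Definition jacobi_nu (alpha beta : R) (s : R) : R :=
  jacobi_w alpha beta s /
  Rintegral (@lebesgue_measure R) `]-1, 1[ (jacobi_w alpha beta).

Definition L2nu_inner (alpha beta : R) (p q : {poly R}) : R :=
  Rintegral (@lebesgue_measure R) `]-1, 1[
    (fun s => p.[s] * q.[s] * jacobi_nu alpha beta s).

(* phi is the orthonormal Jacobi basis: phi i has degree i (index shifted by one
   w.r.t. the paper: paper's phi_{i+1} = our phi i), positive leading coefficient
   (the sign convention of P_n^{(alpha,beta)}), and {phi i} is orthonormal in L^2_nu. *)
Definition is_orthonormal_jacobi (alpha beta : R) (phi : nat -> {poly R}) : Prop :=
  (forall i, size (phi i) = i.+1) /\
  (forall i, 0 < lead_coef (phi i)) /\
  (forall i j, L2nu_inner alpha beta (phi i) (phi j) = (i == j)%:R).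

Definition Linf_norm (p : {poly R}) : R :=
  sup [set `|p.[s]| | s in `]-1, 1[%classic].

Definition mindist (N : nat) (t : 'I_N -> R) (s : R) : R :=
  inf (range (fun n => `|s - t n|)).
Definition density (N : nat) (t : 'I_N -> R) : R :=
  sup [set mindist t s | s in `]-1, 1[%classic].

Definition voronoi (N : nat) (t : 'I_N -> R) (n : 'I_N) : set R :=
  [set s | -1 < s < 1 /\ forall m, m != n -> `|s - t n| <= `|s - t m|].
Definition tau (alpha beta : R) (N : nat) (t : 'I_N -> R) (n : 'I_N) : R :=
  Rintegral (@lebesgue_measure R) (voronoi t n) (jacobi_nu alpha beta).

Definition fval (phi : nat -> {poly R}) (x : nat -> R[i]) (s : R) : R[i] :=
  Complex (limn (series (fun i => complex.Re (x i) * (phi i).[s])))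
          (limn (series (fun i => complex.Im (x i) * (phi i).[s]))).

Definition extM (M : nat) (z : 'cV[R[i]]_M) (i : nat) : R[i] :=
  oapp (fun j : 'I_M => z j ord0) 0 (insub i).

Definition UPM (alpha beta : R) (phi : nat -> {poly R}) (N M : nat)
  (t : 'I_N -> R) (z : 'cV[R[i]]_M) (n : 'I_N) : R[i] :=
  \sum_(i < M) (Num.sqrt (tau alpha beta t n) * (phi i).[t n])%:C%C * z i ord0.

Definition normN (N : nat) (v : 'I_N -> R[i]) : R :=
  Num.sqrt (\sum_(n < N) cmod (v n) ^+ 2).

Definition l2norm (u : nat -> R[i]) : R :=
  Num.sqrt (limn (series (fun i => cmod (u i) ^+ 2))).
Definition wl1norm (w : nat -> R) (u : nat -> R[i]) : R :=
  limn (series (fun i => w i * cmod (u i))).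

Definition tailM (M : nat) (x : nat -> R[i]) (i : nat) : R[i] :=
  if (i < M)%N then 0 else x i.

End JacobiDefs.

(* Main.v *)
Require Import Defs.
From HB Require Import structures.
From mathcomp Require Import all_boot all_order all_algebra.
From mathcomp Require Import all_classical all_reals.
From mathcomp Require Import topology normedtype sequences measure lebesgue_measure
  lebesgue_integral exp.
From mathcomp Require Import complex.
From mathcomp Require Import ereal derive realfun ftc measurable_realfun.
From mathcomp Require Import ring lra.
Import Order.TTheory GRing.Theory Num.Theory numFieldNormedType.Exports.
Local Open Scope classical_set_scope.
Local Open Scope ring_scope.

(** The key estimate is the Marcinkiewicz-Zygmund inequality
    [(1 - eps) * int p^2 nu <= sum_n tau_n p(t_n)^2] for [deg p < M]. On the
    cell of [t_n] the Taylor expansion of [p] at [s] bounds [p(t_n) - p(s)]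
    by the derivatives of [p] at [s] itself, so that the inequality follows
    from the global Markov inequality [int p'^2 nu <= K M^4 int p^2 nu], with
    no local analysis of the weight near the endpoints.

    Markov's inequality combines a Bernstein inequality
    [int (1 - x^2) p'^2 nu <= A M^2 int p^2 nu] (the Jacobi differential
    operator is symmetric with eigenvalues of order [M^2]) with
    [int q^2 nu <= C M^2 int (1 - x^2) q^2 nu]. Both use about [nu] only that
    it is a positive functional satisfying one integration by parts formula,
    the Pearson equation [((1 - x^2) w)' = (beta - alpha - (alpha + beta + 2) x) w].

    The matrix of the least-squares problem is real and, by the above,
    injective with constant [1 - eps]; the minimiser is given by the normal
    equations, and the residual at [P_M x] is at most
    [||x - P_M x||_{1,w} + eta] because [sum_n tau_n = 1]. *)

(** * Bernstein, Schur and Markov inequalities for a positive functional with a Pearson identity *)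

Section PearsonFunctional.
Variables (R : realFieldType) (alpha beta : R) (I : {scalar {poly R}}).
Variable phi : nat -> {poly R}.

(* [sg] times the weight has derivative [lg] times the weight. *)
Local Notation sg := (1 - 'X^2 : {poly R}).
Local Notation lg := ((beta - alpha)%:P - (alpha + beta + 2) *: 'X : {poly R}).

Hypothesis I_ge0 : forall p : {poly R},
  (forall s : R, -1 < s < 1 -> 0 <= p.[s]) -> 0 <= I p.
Hypothesis I_ibp : forall p, I (sg * p^`() + lg * p) = 0.
Hypothesis size_phi : forall i, size (phi i) = i.+1.
Hypothesis phi_orth : forall i j, I (phi i * phi j) = (i == j)%:R.

(** The Jacobi differential operator: for a weight [w] with [(sg w)' = lg w], it is
    [(sg w p')' / w]. *)
Let D (p : {poly R}) : {poly R} := sg * p^`()^`() + lg * p^`().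

Lemma functional_le (p q : {poly R}) :
  (forall s : R, -1 < s < 1 -> p.[s] <= q.[s]) -> I p <= I q.
Proof.
move=> pq; rewrite -subr_ge0 -linearB; apply: I_ge0 => s /pq.
by rewrite hornerD hornerN subr_ge0.
Qed.

Lemma functional_sqr_ge0 (p : {poly R}) : 0 <= I (p * p).
Proof. by apply: I_ge0 => s _; rewrite hornerM -expr2 sqr_ge0. Qed.

(** Green's formula, obtained from [I_ibp] at [p' q]; it makes [D] symmetric. *)
Lemma pearson_green (p q : {poly R}) : I (sg * (p^`() * q^`())) = - I (q * D p).
Proof.
have := I_ibp (p^`() * q); rewrite derivM => h; apply/eqP.
rewrite -addr_eq0 -linearD -[X in _ == X]h /D; apply/eqP; congr (I _); ring.
Qed.

Lemma pearson_green_sym (p q : {poly R}) : I (q * D p) = I (p * D q).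
Proof. by apply: oppr_inj; rewrite -!pearson_green [q^`() * _]mulrC. Qed.

Lemma phi_lead_neq0 m : (phi m)`_m != 0.
Proof. by rewrite -[m]/(m.+1.-1) -{2}size_phi -lead_coefE lead_coef_eq0 -size_poly_gt0
  size_phi. Qed.

Lemma phi_split m (p : {poly R}) : (size p <= m.+1)%N ->
  exists (a : R) (r : {poly R}), p = a *: phi m + r /\ (size r <= m)%N.
Proof.
move=> sp; exists (p`_m / (phi m)`_m), (p - (p`_m / (phi m)`_m) *: phi m).
split; first by rewrite addrC subrK.
apply/leq_sizeP => j; rewrite leq_eqVlt => /predU1P[<-|mj].
  by rewrite coefB coefZ divfK ?subrr ?phi_lead_neq0.
rewrite coefB coefZ (nth_default _ (leq_trans sp mj)) sub0r.
by rewrite [X in _ * X]nth_default ?size_phi // mulr0 oppr0.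
Qed.

Lemma phi_orth_lower m (r : {poly R}) : (size r <= m)%N -> I (phi m * r) = 0.
Proof.
suff H k (q : {poly R}) : (k <= m)%N -> (size q <= k)%N -> I (phi m * q) = 0.
  exact: H.
elim: k q => [|k IH] q km.
  by rewrite leqn0 size_poly_eq0 => /eqP ->; rewrite mulr0 linear0.
move=> /phi_split [a [r' [-> sr]]].
rewrite mulrDr linearD /= (IH r') ?(ltnW km) // addr0 -scalerAr linearZ /= phi_orth.
by rewrite gtn_eqF // mulr0.
Qed.

(** On the top coefficient [sg p''] acts by [- m (m - 1)] and [lg p'] by [- (alpha + beta + 2) m];
    together they give the eigenvalue of [D] in degree [m]. *)
Lemma coef_D_top m (p : {poly R}) : (size p <= m.+1)%N ->
  (D p)`_m = - (m%:R * (m%:R + alpha + beta + 1)) * p`_m.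
Proof.
move=> sp; have p0 k : (m < k)%N -> p`_k = 0.
  by move=> mk; rewrite nth_default // (leq_trans sp).
rewrite /D 2!mulrBl mul1r !(coefD, coefN) !mul_polyC coefXnM.
rewrite -!scalerAl !coefZ coefXM !coef_deriv (p0 m.+1) // (p0 m.+2) // !mul0rn.
case: m sp p0 => [|[|m]] sp p0 /=; rewrite ?subn2 /=.
- by rewrite mul0r oppr0 mul0r; ring.
- by rewrite mulr1n; ring.
- rewrite -[_ *+ m.+1]mulr_natr -(mulr_natr p`_m.+2) -(natr1 m.+1) -(natr1 m).
  by ring.
Qed.

Lemma size_D m (p : {poly R}) : (size p <= m)%N -> (size (D p) <= m)%N.
Proof.
move=> sp; apply/leq_sizeP => j mj; rewrite coef_D_top ?nth_default ?mulr0 //.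
all: by rewrite (leq_trans sp) // ltnW.
Qed.

(** Induction on the degree, splitting off the component along [phi m.+1]. Orthogonality and the
    symmetry of [D] kill the cross terms, so that each component contributes its eigenvalue, of
    order [m ^+ 2], times its squared coefficient. *)
Lemma pearson_bernstein : exists2 A : R, 1 <= A &
  forall m (p : {poly R}), (size p <= m.+1)%N ->
    I (sg * (p^`() * p^`())) <= A * m%:R ^+ 2 * I (p * p).
Proof.
pose A : R := 1 + `|alpha + beta + 1|.
have A0 : 0 <= A by rewrite addr_ge0.
exists A => [|m p]; first by rewrite lerDl.
elim: m p => [|m IH] p.
  move=> /size1_polyC ->; rewrite derivC !mul0r mulr0 linear0.
  by rewrite expr0n mulr0 mul0r.
have sDphi := @size_D m.+2 (phi m.+1).
move=> /phi_split [a [r [-> sr]]]; have := IH r sr; rewrite !pearson_green.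
have o1 : I (phi m.+1 * r) = 0 by exact: phi_orth_lower.
have o2 : I (phi m.+1 * D r) = 0 by apply: phi_orth_lower; exact: size_D.
set mu : R := m.+1%:R * (m.+1%:R + alpha + beta + 1).
have o3 : I (phi m.+1 * D (phi m.+1)) = - mu.
  (* Adding [mu *: phi m.+1] cancels the top coefficient of [D (phi m.+1)], and what is left has
     lower degree. *)
  suff : I (phi m.+1 * (D (phi m.+1) + mu *: phi m.+1)) = 0.
    rewrite mulrDr linearD /= -scalerAr linearZ /= phi_orth eqxx mulr1.
    by move=> /eqP; rewrite addr_eq0 => /eqP.
  apply: phi_orth_lower; apply/leq_sizeP => j; rewrite leq_eqVlt => /predU1P[<-|mj].
    by rewrite coefD coefZ coef_D_top ?size_phi // mulNr addNr.
  by rewrite coefD coefZ !nth_default ?mulr0 ?addr0 ?size_phi //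
    (leq_trans (sDphi _)) ?size_phi.
have e1 : I ((a *: phi m.+1 + r) * D (a *: phi m.+1 + r)) = - (mu * a ^+ 2) + I (r * D r).
  have -> : (a *: phi m.+1 + r) * D (a *: phi m.+1 + r) =
     (a ^+ 2) *: (phi m.+1 * D (phi m.+1)) + a *: (phi m.+1 * D r)
     + a *: (r * D (phi m.+1)) + r * D r.
    by rewrite /D !derivD !derivZ -!mul_polyC; ring.
  rewrite 3!linearD /= 3!linearZ /= [I (r * D (phi m.+1))]pearson_green_sym o2 o3.
  by rewrite !mulr0 !addr0 mulrN mulrC.
have e2 : I ((a *: phi m.+1 + r) * (a *: phi m.+1 + r)) = a ^+ 2 + I (r * r).
  have -> : (a *: phi m.+1 + r) * (a *: phi m.+1 + r) =
     (a ^+ 2) *: (phi m.+1 * phi m.+1) + (2 * a) *: (phi m.+1 * r) + r * r.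
    by rewrite -!mul_polyC; ring.
  by rewrite 2!linearD /= 2!linearZ /= o1 phi_orth eqxx mulr1 mulr0 addr0.
rewrite e1 e2 => h.
have mu_le : mu <= A * m.+1%:R ^+ 2.
  rewrite /mu /A mulrDl mul1r -addrA -addrA mulrDr -expr2 lerD2l addrA.
  rewrite mulrC; apply: (@le_trans _ _ (`|alpha + beta + 1| * m.+1%:R)).
    by rewrite ler_wpM2r // ler_norm.
  by rewrite ler_wpM2l // -natrX ler_nat expnS expn1 leq_pmulr.
have mm : m%:R ^+ 2 <= m.+1%:R ^+ 2 :> R by rewrite -!natrX ler_nat leq_exp2r.
have h1 : mu * a ^+ 2 <= A * m.+1%:R ^+ 2 * a ^+ 2 by rewrite ler_wpM2r ?sqr_ge0.
have h2 : A * m%:R ^+ 2 * I (r * r) <= A * m.+1%:R ^+ 2 * I (r * r).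
  by rewrite ler_wpM2r ?functional_sqr_ge0 // ler_wpM2l.
rewrite opprD opprK [leRHS]mulrDr; exact: lerD h1 (le_trans h h2).
Qed.

Hypotheses (alpha_gt : -1 < alpha) (beta_gt : -1 < beta).

(* Integrate by parts against [x q^2]: [- x lg(x)] is positive at both
   endpoints, hence at least [d - K sg(x)] on the interval. *)
Lemma pearson_schur : exists2 C : R, 0 < C &
  forall m (q : {poly R}), (size q <= m.+1)%N ->
    I (q * q) <= C * m.+1%:R ^+ 2 * I (sg * (q * q)).
Proof.
have [a1 b1] : -1 < alpha /\ -1 < beta by [].
have [d d0 dmin] : exists2 d : R, 0 < d & forall s : R, -1 < s < 1 ->
    d <= (alpha + 1) * (1 + s) + (beta + 1) * (1 - s).
  have [m [m0 m1 m2]] : exists m : R, [/\ 0 < m, m <= alpha + 1 & m <= beta + 1].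
    exists (Num.min (alpha + 1) (beta + 1)).
    have a0 : 0 < alpha + 1 by lra.
    have b0 : 0 < beta + 1 by lra.
    by rewrite ge_min lexx ge_min lexx orbT lt_min a0 b0.
  (* The function to be bounded is affine in [s], with values [2 (beta + 1)] and [2 (alpha + 1)] at
     the endpoints. *)
  exists (2 * m); first by rewrite mulr_gt0.
  by move=> s /andP[s1 s2]; nra.
have [A A1 bern0] := pearson_bernstein.
have [K K1 KE] : exists2 K : R, 0 <= K + 1 & K = alpha + beta + 2.
  by exists (alpha + beta + 2) => //; lra.
have A0 : 0 < A by rewrite (lt_le_trans _ A1).
exists (2 / d * (K + 1 + 2 * A / d)).
  by apply: mulr_gt0; rewrite ?ltr_wpDl // !(divr_gt0, mulr_gt0).
move=> m q sq; set n : R := m.+1%:R.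
have n1 : 1 <= n by rewrite ler1n.
have n2 : 1 <= n ^+ 2 by rewrite exprn_ege1.
have Sq0 : 0 <= I (sg * (q * q)).
  apply: I_ge0 => s /andP[s1 s2]; rewrite 2!hornerM mulr_ge0 // -?expr2 ?sqr_ge0 //.
  by rewrite !hornerE; nra.
(* Chosen so that [th] times the Bernstein bound is [d / 2 * I (q * q)], half of the left side of
   [key], which absorbs it. *)
pose th := d / (2 * A * n ^+ 2).
have th0 : 0 < th by rewrite divr_gt0 // !mulr_gt0 // (lt_le_trans _ n2).
have bern : I (sg * (q^`() * q^`())) <= A * n ^+ 2 * I (q * q).
  apply: le_trans (bern0 m q sq) _; rewrite ler_wpM2r ?functional_sqr_ge0 //.
  rewrite ler_wpM2l ?(ltW A0) // -!natrX ler_nat leq_exp2r //.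
clearbody n; have n0 : n != 0 by rewrite gt_eqF // (lt_le_trans _ n1).
(* With [K = alpha + beta + 2], [- x lg] equals [(alpha + 1) (1 + x) + (beta + 1) (1 - x) - K sg].
   The derivative of [x q^2] adds one more [sg q^2] and the mixed term [2 x q q' sg], which is split
   by a weighted arithmetic-geometric inequality. *)
have key : d * I (q * q) <= (K + 1 + th^-1) * I (sg * (q * q))
    + th * I (sg * (q^`() * q^`())).
  have ibp := I_ibp ('X * (q * q)).
  (* The vanishing integral [ibp] is added on the left, which leaves a pointwise inequality between
     integrands. *)
  rewrite -[leLHS]add0r -[X in X + _ <= _]ibp -!linearZ -!linearD;
    apply: functional_le => s /andP[s1 s2].
  rewrite !(derivM, derivX) !(hornerD, hornerN, hornerM, hornerXn, hornerC, hornerZ,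
    hornerX); set a := q.[s]; set b := q^`().[s].
  have amgm : 2 * s * (a * b) <= th^-1 * (a * a) + th * (b * b).
    have e1 : th^-1 * (a * a) + th * (b * b) - 2 * s * (a * b) =
        th^-1 * ((a - s * th * b) ^+ 2) + th * (1 - s ^+ 2) * b ^+ 2.
      by field; rewrite gt_eqF.
    rewrite -subr_ge0 e1 addr_ge0 // mulr_ge0 ?sqr_ge0 ?invr_ge0 ?(ltW th0) //.
    rewrite mulr_ge0 ?(ltW th0) // subr_ge0; nra.
  have h1 : d * (a * a) <= ((alpha + 1) * (1 + s) + (beta + 1) * (1 - s)) * (a * a).
    by rewrite ler_wpM2r ?dmin ?s1 // -expr2 sqr_ge0.
  have S0 : 0 <= 1 - s ^+ 2 by nra.
  have h2 := ler_wpM2l S0 amgm.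
  rewrite KE; nra.
have h3 : th * I (sg * (q^`() * q^`())) <= d / 2 * I (q * q).
  apply: le_trans (ler_wpM2l (ltW th0) bern) _.
  rewrite mulrA le_eqVlt; apply/predU1P; left; congr (_ * _).
  by rewrite /th; field; rewrite n0 !gt_eqF.
have h4 : I (q * q) <= 2 / d * ((K + 1 + th^-1) * I (sg * (q * q))).
  rewrite -ler_pdivrMl ?divr_gt0 //.
  have -> : (2 / d)^-1 = d / 2 by field; rewrite gt_eqF.
  by lra.
have thE : th^-1 = 2 * A / d * n ^+ 2 by rewrite /th; field; rewrite n0 !gt_eqF.
have cmp : K + 1 + th^-1 <= (K + 1 + 2 * A / d) * n ^+ 2.
  by rewrite thE [leRHS]mulrDl lerD2r ler_peMr.
have -> : 2 / d * (K + 1 + 2 * A / d) * n ^+ 2 * I (sg * (q * q)) =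
  2 / d * ((K + 1 + 2 * A / d) * n ^+ 2 * I (sg * (q * q))) by rewrite !mulrA.
apply: le_trans h4 _; rewrite ler_wpM2l ?ler_wpM2r //.
by rewrite mulr_ge0 ?invr_ge0 ?(ltW d0).
Qed.

(** Schur's inequality for [p'] followed by Bernstein's for [p], each at the cost of a factor of
    order [M ^+ 2]. *)
Lemma pearson_markov : exists2 K : R, 0 < K &
  forall M (p : {poly R}), (size p <= M)%N ->
    I (p^`() * p^`()) <= K * M%:R ^+ 4 * I (p * p).
Proof.
have [C C0 schur] := pearson_schur.
have [A A1 bern] := pearson_bernstein.
exists (C * A); first by rewrite mulr_gt0 // (lt_le_trans _ A1).
case=> [|m] p sp.
  by rewrite (size_poly_leq0P _ sp) derivC !mul0r linear0 mulr0.
apply: le_trans (schur m p^`() _) _.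
  by rewrite (leq_trans (size_poly _ _)) // (leq_trans (leq_pred _)).
have b := bern m p sp.
have C1 : 0 <= C * m.+1%:R ^+ 2 by rewrite mulr_ge0 ?sqr_ge0 // ltW.
apply: le_trans (ler_wpM2l C1 b) _.
have -> : C * A * m.+1%:R ^+ 4 * I (p * p) =
  C * m.+1%:R ^+ 2 * (A * m.+1%:R ^+ 2 * I (p * p)) by ring.
rewrite ler_wpM2l // ler_wpM2r ?functional_sqr_ge0 // ler_wpM2l ?(le_trans _ A1) //.
by rewrite -!natrX ler_nat leq_exp2r.
Qed.

(** Stated for the derivatives divided by [k!], which are the Taylor coefficients; the division only
    decreases the left side. *)
Lemma pearson_markov_iter : exists2 K : R, 0 < K &
  forall M k (p : {poly R}), (size p <= M)%N ->
    I (p^`N(k) * p^`N(k)) <= (K * M%:R ^+ 4) ^+ k * I (p * p).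
Proof.
have [K K0 markov] := pearson_markov; exists K => // M k p sp.
have B0 : 0 <= K * M%:R ^+ 4 by rewrite mulr_ge0 ?exprn_ge0 // ltW.
have iter : (size p^`(k) <= M)%N /\
    I (p^`(k) * p^`(k)) <= (K * M%:R ^+ 4) ^+ k * I (p * p).
  elim: k => [|k [IH1 IH2]]; first by rewrite derivn0 expr0 mul1r.
  rewrite derivnS; split.
    by rewrite (leq_trans (size_poly _ _)) // (leq_trans (leq_pred _)).
  apply: le_trans (markov M _ IH1) _.
  by rewrite [in leRHS](exprS (_ * _)) -[leRHS]mulrA; apply: ler_wpM2l.
apply: le_trans iter.2; apply: functional_le => s _.
rewrite nderivn_def !hornerE hornerMn.
rewrite -!expr2 exprMn_n -mulr_natr ler_peMr ?sqr_ge0 //.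
by rewrite ler1n expn_gt0 fact_gt0.
Qed.

End PearsonFunctional.

(** * Pointwise Taylor estimate *)

Lemma sqr_sum_le (R : realFieldType) n (a : nat -> R) :
  (\sum_(k < n) a k) ^+ 2 <= \sum_(k < n) 2 ^+ k.+1 * a k ^+ 2.
Proof.
elim: n a => [|n IH] a; first by rewrite !big_ord0 expr0n.
rewrite !big_ord_recl /= expr1.
have := IH (fun k => a k.+1); set s := \sum_(k < n) a _; set s2 := \sum_(k < n) _ => h.
have -> : \sum_(i < n) 2 ^+ (bump 0 i).+1 * a (bump 0 i) ^+ 2 = 2 * s2.
  by rewrite mulr_sumr; apply: eq_bigr => i _; rewrite /bump /= add1n exprS mulrA.
(* This is [(a 0 + s) ^+ 2 <= 2 * a 0 ^+ 2 + 2 * s ^+ 2]; the factor 2 on the tail shifts its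
   weights by one. *)
have : 0 <= (a 0 - s) ^+ 2 by rewrite sqr_ge0.
nra.
Qed.

(** Taylor's formula at [s], then Cauchy-Schwarz with weights [2 ^- k.+1]: instead of a factor
    depending on [n], they cost a geometric one, which merges with the powers of [h ^+ 2]. *)
Lemma taylor_sqr_le (R : realFieldType) n (p : {poly R}) (s t h : R) :
  (size p <= n.+1)%N -> `|s - t| <= h ->
  (p.[t] - p.[s]) ^+ 2 <=
  \sum_(k < n) (2 * h ^+ 2) ^+ k.+1 * (p^`N(k.+1)).[s] ^+ 2.
Proof.
move=> sp sth.
have -> : p.[t] = p.[s + (t - s)] by rewrite addrC subrK.
rewrite (@nderiv_taylor_wide _ n.+1) //; last exact: mulrC.
rewrite big_ord_recl nderivn0 expr0 mulr1 addrAC subrr add0r.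
apply: le_trans (@sqr_sum_le R n (fun k => (p^`N(k.+1)).[s] * (t - s) ^+ k.+1)) _.
apply: ler_sum => k _; rewrite exprMn [leLHS]mulrCA [leLHS]mulrC.
rewrite ler_wpM2r ?sqr_ge0 // -exprM mulnC exprM -(exprMn k.+1).
have th2 : (t - s) ^+ 2 <= h ^+ 2.
  by rewrite -[leLHS]real_normK ?num_real // distrC lerXn2r ?nnegrE // (le_trans _ sth).
apply: lerXn2r; last by rewrite ler_wpM2l.
  by rewrite nnegrE mulr_ge0 ?sqr_ge0.
by rewrite nnegrE mulr_ge0 ?sqr_ge0.
Qed.

(** * Continuity of powers and one-sided limits at the endpoints *)

Lemma powR_continuous_at (R : realType) (a x : R) : 0 < x ->
  {for x, continuous (@powR R ^~ a)}.
Proof.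
move=> x0; apply/differentiable_continuous/derivable1_diffP.
exact: (@ex_derive _ _ _ _ _ _ _ (is_derive1_powR a x0)).
Qed.

(** The limit is taken in [0^'+], to be composed with the limit of a positive power at 0 from the
    right. *)
Lemma cvg_onem_at_left1 (R : realType) : 1 - s @[s --> (1 : R)^'-] --> (0 : R)^'+.
Proof.
move=> A; rewrite /at_right /at_left /= => -[e /= e0 eA].
exists e => //= s /= es s1; apply: eA; last by rewrite subr_gt0.
by move: es; rewrite /= sub0r normrN.
Qed.

Lemma cvg_addr1_at_rightN1 (R : realType) : 1 + s @[s --> (-1 : R)^'+] --> (0 : R)^'+.
Proof.
move=> A; rewrite /at_right /= => -[e /= e0 eA].
exists e => //= s /= es s1; apply: eA; last by rewrite -ltrBlDl sub0r.
by move: es; rewrite /= sub0r normrN -opprD normrN.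
Qed.

Lemma near_left1 (R : realType) : \forall x \near (1 : R)^'-, -1 < x < 1.
Proof.
near=> x; apply/andP; split; near: x; last exact: nbhs_left_lt.
by apply: nbhs_left_gt; lra.
Unshelve. all: by end_near. Qed.

Lemma near_rightN1 (R : realType) : \forall x \near (-1 : R)^'+, -1 < x < 1.
Proof.
near=> x; apply/andP; split; near: x; first exact: nbhs_right_gt.
by apply: nbhs_right_lt; lra.
Unshelve. all: by end_near. Qed.

(** * The Jacobi weight and its integration by parts formula *)

Section Weight.
Context (R : realType) (alpha beta : R).
Local Notation mu := (@lebesgue_measure R).
Local Notation w := (jacobi_w alpha beta).

Let sg : {poly R} := 1 - 'X^2.
Let lg : {poly R} := (beta - alpha)%:P - (alpha + beta + 2) *: 'X.

Lemma jacobi_w_ge0 s : 0 <= w s.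
Proof. by rewrite /jacobi_w mulr_ge0 ?powR_ge0. Qed.

Lemma measurable_jacobi_w A : measurable_fun A w.
Proof.
apply: measurable_funTS; apply: measurable_funM.
  by apply: (@measurableT_comp _ _ _ _ _ _ (@powR R ^~ alpha)) => //;
    apply: measurable_funB.
by apply: (@measurableT_comp _ _ _ _ _ _ (@powR R ^~ beta)) => //; apply: measurable_funD.
Qed.

Lemma horner_bounded (p : {poly R}) : exists2 C, 0 < C &
  forall s, -1 <= s <= 1 -> `|p.[s]| <= C.
Proof.
exists (1 + \sum_(i < size p) `|p`_i|); first by rewrite ltr_wpDr ?sumr_ge0.
move=> s; rewrite -ler_norml => s1; rewrite horner_coef.
apply: le_trans (ler_norm_sum _ _ _) _; rewrite -[leLHS]add0r lerD //.
apply: ler_sum => i _; rewrite normrM normrX ler_piMr //.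
by rewrite exprn_ile1.
Qed.

Lemma measurable_horner (p : {poly R}) A : measurable_fun A (horner p).
Proof. by apply: measurable_funTS; apply: continuous_measurable_fun;
  exact: continuous_horner. Qed.

Lemma integrable_hornerM (f : R -> R) (p : {poly R}) :
  mu.-integrable `]-1, 1[ (EFin \o f) ->
  mu.-integrable `]-1, 1[ (EFin \o (fun s => p.[s] * f s)).
Proof.
move=> fi; apply: (@eq_integrable _ _ _ mu _ _ ((EFin \o horner p) \* (EFin \o f))%E)
  => //.
apply: integrableMr => //; first exact: measurable_horner.
have [C C0 bC] := horner_bounded p.
exists C; split; first by rewrite num_real.
move=> x Cx s /=; rewrite in_itv /= => /andP[s1 s2].
by apply: le_trans (ltW Cx); apply: bC; rewrite !ltW.
Qed.

Hypotheses (alpha_gt : -1 < alpha) (beta_gt : -1 < beta).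

(** [p (1 - s^2) w] with the factor [1 - s^2] absorbed into the exponents, which become positive:
    [F p] tends to 0 at both endpoints. *)
Let F (p : {poly R}) (s : R) := p.[s] * ((1 - s) `^ (alpha + 1) * (1 + s) `^ (beta + 1)).

Lemma is_derive_jacobi_primitive (p : {poly R}) (s : R) : -1 < s < 1 ->
  is_derive s 1 (F p) ((sg * p^`() + lg * p).[s] * w s).
Proof.
move=> /andP[s1 s2].
have o1 : 0 < 1 - s by rewrite subr_gt0.
have o2 : 0 < 1 + s by rewrite -ltrBlDl sub0r.
have d1 : is_derive s 1 (fun x : R => (1 - x) `^ (alpha + 1))
    (- ((alpha + 1) * (1 - s) `^ (alpha + 1 - 1))).
  have h2 : is_derive s 1 (cst 1 - id : R -> R) (0 - 1) by apply: is_deriveB.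
  have h1 := is_derive1_powR (alpha + 1) o1.
  have h := @is_derive1_comp R (@powR R ^~ (alpha + 1)) (cst 1 - id) s _ _ h1 h2.
  by apply: (@is_derive_eq _ _ _ _ _ _ _ _ h); rewrite sub0r mulrN1.
have d2 : is_derive s 1 (fun x : R => (1 + x) `^ (beta + 1))
    ((beta + 1) * (1 + s) `^ (beta + 1 - 1)).
  have h2 : is_derive s 1 (cst 1 + id : R -> R) (0 + 1) by apply: is_deriveD.
  have h1 := is_derive1_powR (beta + 1) o2.
  have h := @is_derive1_comp R (@powR R ^~ (beta + 1)) (cst 1 + id) s _ _ h1 h2.
  by apply: (@is_derive_eq _ _ _ _ _ _ _ _ h); rewrite add0r mulr1.
have d3 : is_derive s 1 (horner p) (p^`()).[s].
  split; first exact: derivable_horner.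
  by rewrite -derive1E derivE.
have h := is_deriveM d3 (is_deriveM d1 d2).
apply: (@is_derive_eq _ _ _ _ _ _ _ _ h); rewrite /= !addrK /jacobi_w.
have powR1D (a x : R) : 0 < x -> x `^ (a + 1) = x `^ a * x.
  by move=> x0; rewrite powRD ?powRr1 ?(ltW x0) // (gt_eqF x0) implybT.
change (((fun x : R => (1 - x) `^ (alpha + 1)) * (fun x : R => (1 + x) `^ (beta + 1))) s)
  with ((1 - s) `^ (alpha + 1) * (1 + s) `^ (beta + 1)).
rewrite !powR1D //.
set u := (1 - s) `^ alpha; set v := (1 + s) `^ beta.
transitivity (p.[s] * (u * (1 - s) * ((beta + 1) * v) +
    v * (1 + s) * - ((alpha + 1) * u)) + u * (1 - s) * (v * (1 + s)) * p^`().[s]).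
  by [].
by rewrite /sg /lg !(hornerD, hornerN, hornerM, hornerXn, hornerC, hornerZ, hornerX);
  ring.
Qed.

Hypothesis w_int : mu.-integrable `]-1, 1[ (EFin \o w).

(** The integrand is the derivative of [F p], which vanishes at the endpoints. It may be unbounded
    there, so the fundamental theorem is used on compact subintervals and the endpoints are reached
    by limits. *)
Lemma jacobi_ibp (p : {poly R}) :
  \int[mu]_(s in `]-1, 1[) ((sg * p^`() + lg * p).[s] * w s) = 0.
Proof.
have [agt bgt] : -1 < alpha /\ -1 < beta by [].
set g := fun s => _ * _.
have gi : mu.-integrable `]-1, 1[ (EFin \o g) by exact: integrable_hornerM.
(* Extended by zero, the integrand is integrable on the closed interval, where its primitive [G] is
   continuous up to the endpoints. *)
pose g0 := g \_ `]-1, 1[.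
have g0i (A : set R) : measurable A -> mu.-integrable A (EFin \o g0).
  move=> mA; apply: (@integrableS _ _ _ mu setT) => //.
  by rewrite /g0 -restrict_EFin; apply: (iffLR (integrable_mkcond _ _)).
pose G (x : R) := \int[mu]_(s in `[-1, x]) g0 s.
have cG : {within `[-1, 1], continuous G}.
  apply: (@parameterized_integral_continuous _ (-1) 1 g0); first lra.
  exact: g0i.
have [_ cG1 cG2] := (continuous_within_itvP G (ltac:(lra) : -1 < 1 :> R)).1 cG.
have GN1 : G (-1) = 0 by rewrite /G set_itv1 Rintegral_set1.
have FG (a b : R) : -1 < a -> a < b -> b < 1 -> F p b - F p a = G b - G a.
  move=> a1 ab b1.
  have sub x : a <= x <= b -> -1 < x < 1.
    by move=> /andP[ax xb]; rewrite (lt_le_trans a1 ax) (le_lt_trans xb b1).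
  have cF x : a <= x <= b -> {for x, continuous (F p)}.
    move=> /sub x1; apply/differentiable_continuous/derivable1_diffP.
    exact: (@ex_derive _ _ _ _ _ _ _ (is_derive_jacobi_primitive p x x1)).
  have cg : {within `[a, b], continuous g}.
    apply: continuous_in_subspaceT => x; rewrite inE /= in_itv /= => /sub /andP[x1 x2].
    apply: continuousM; first exact: continuous_horner.
    apply: continuousM.
      apply: (@continuous_comp _ _ _ (fun s : R => 1 - s) (@powR R ^~ alpha)).
        by apply: cvgB; [exact: cvg_cst | exact: cvg_id].
      by apply: powR_continuous_at; lra.
    apply: (@continuous_comp _ _ _ (fun s : R => 1 + s) (@powR R ^~ beta)).
      by apply: cvgD; [exact: cvg_cst | exact: cvg_id].
    by apply: powR_continuous_at; lra.
  have ftc : \int[mu]_(x in `[a, b]) g x = F p b - F p a.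
    rewrite /Rintegral (@continuous_FTC2 _ g (F p)) //; first split.
    - move=> x; rewrite in_itv /= => /andP[ax xb].
      have x1 : -1 < x < 1 by apply: sub; rewrite !ltW.
      exact: (@ex_derive _ _ _ _ _ _ _ (is_derive_jacobi_primitive p x x1)).
    - by apply: cvg_at_right_filter; apply: cF; rewrite lexx ltW.
    - by apply: cvg_at_left_filter; apply: cF; rewrite lexx ltW.
    - move=> x; rewrite in_itv /= => /andP[ax xb].
      have x1 : -1 < x < 1 by apply: sub; rewrite !ltW.
      rewrite derive1E.
      exact: (@derive_val _ _ _ _ _ _ _ (is_derive_jacobi_primitive p x x1)).
  rewrite -ftc /G (@Rintegral_itvB _ g0 (BLeft (-1)) (BRight b) a) ?bnd_simp ?ltW //;
    last exact: g0i.
  rewrite Rintegral_itv_obnd_cbnd; last exact: g0i.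
  apply: eq_Rintegral => x; rewrite inE /= in_itv /= => /sub x1.
  by rewrite /g0 patchE mem_set //= in_itv.
(* [F p - G] is constant on the open interval; its limits at the endpoints are [- G 1] and
   [- G (-1) = 0]. *)
have FG0 (x : R) : -1 < x < 1 -> F p x - G x = F p 0 - G 0.
  move=> /andP[x1 x2]; case: (ltgtP x 0) => [x0|x0|-> //].
    by have := FG x 0 x1 x0 ltr01 => h; lra.
  by have := FG 0 x (ltac:(lra)) x0 x2 => h; lra.
have FL : F p s @[s --> (1 : R)^'-] --> 0.
  have c1 : p.[s] @[s --> (1 : R)^'-] --> p.[1].
    by apply: cvg_at_left_filter; exact: continuous_horner.
  have c2 : (1 - s) `^ (alpha + 1) @[s --> (1 : R)^'-] --> 0.
    apply: (@cvg_comp _ _ _ (fun s : R => 1 - s) (@powR R ^~ (alpha + 1)) _ _ _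
      (@cvg_onem_at_left1 R)).
    by apply: powR_cvg0; lra.
  have c3 : (1 + s) `^ (beta + 1) @[s --> (1 : R)^'-] --> (1 + 1) `^ (beta + 1).
    apply: cvg_at_left_filter.
    apply: (@continuous_comp _ _ _ (fun s : R => 1 + s) (@powR R ^~ (beta + 1))).
      by apply: cvgD; [exact: cvg_cst | exact: cvg_id].
    by apply: powR_continuous_at.
  have := cvgM c1 (cvgM c2 c3); rewrite mul0r mulr0; exact.
have FR : F p s @[s --> (-1 : R)^'+] --> 0.
  have c1 : p.[s] @[s --> (-1 : R)^'+] --> p.[-1].
    by apply: cvg_at_right_filter; exact: continuous_horner.
  have c3 : (1 + s) `^ (beta + 1) @[s --> (-1 : R)^'+] --> 0.
    apply: (@cvg_comp _ _ _ (fun s : R => 1 + s) (@powR R ^~ (beta + 1)) _ _ _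
      (@cvg_addr1_at_rightN1 R)).
    by apply: powR_cvg0; lra.
  have c2 : (1 - s) `^ (alpha + 1) @[s --> (-1 : R)^'+] --> (1 - -1) `^ (alpha + 1).
    apply: cvg_at_right_filter.
    apply: (@continuous_comp _ _ _ (fun s : R => 1 - s) (@powR R ^~ (alpha + 1))).
      by apply: cvgB; [exact: cvg_cst | exact: cvg_id].
    by apply: powR_continuous_at; lra.
  have := cvgM c1 (cvgM c2 c3); rewrite !mulr0; exact.
have k1 : F p 0 - G 0 = 0 - G 1.
  have c4 : (fun x => F p x - G x) @ (1 : R)^'- --> 0 - G 1 by exact: cvgB.
  rewrite -(cvg_lim _ c4) //; apply/esym/cvg_lim => //.
  by apply: cvg_near_cst; apply: filterS (@near_left1 R) => x; exact: FG0.
have k2 : F p 0 - G 0 = 0 - G (-1).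
  have c4 : (fun x => F p x - G x) @ (-1 : R)^'+ --> 0 - G (-1) by exact: cvgB.
  rewrite -(cvg_lim _ c4) //; apply/esym/cvg_lim => //.
  by apply: cvg_near_cst; apply: filterS (@near_rightN1 R) => x; exact: FG0.
have : G 1 = 0 by move: k2; rewrite k1 GN1; lra.
rewrite /G /g0 -Rintegral_mkcondr setIidr //.
exact: subset_itv_oo_cc.
Qed.

End Weight.

(** * Voronoi cells as a partition up to a null set *)

Section Voronoi.
Context (R : realType) (N : nat) (t : 'I_N -> R).
Local Notation mu := (@lebesgue_measure R).
Hypotheses (N_gt0 : (0 < N)%N) (t_inj : injective t).

Lemma voronoi_sub n : voronoi t n `<=` `]-1, 1[.
Proof. by move=> s [s1 _]; rewrite /= in_itv. Qed.

Lemma measurable_voronoi n : measurable (voronoi t n).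
Proof.
rewrite (_ : voronoi t n = `]-1, 1[ `&`
    \bigcap_(m in [set m | m != n]) [set s | `|s - t n| <= `|s - t m|]).
  apply: measurableI => //; apply: fin_bigcap_measurable; first exact: finite_finset.
  move=> m _; pose h := fun s : R => `|s - t n| - `|s - t m|.
  have mh : measurable_fun [set: R] h.
    apply: continuous_measurable_fun => x.
    by apply: cvgB; apply: cvg_norm; apply: cvgB; do [exact: cvg_id | exact: cvg_cst].
  rewrite (_ : [set s | _] = setT `&` h @^-1` `]-oo, 0]); first exact: mh.
  by rewrite setTI; apply/seteqP; split => s; rewrite /h /= in_itv /= subr_le0.
apply/seteqP; split => [s [s1 h]|s [s1 h]].
  by split; [rewrite /= in_itv | move=> m mn; exact: h].
split; first by move: s1; rewrite /= in_itv.
by move=> m mn; exact: h.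
Qed.

Lemma voronoi_cover s : -1 < s < 1 -> exists n, voronoi t n s.
Proof.
move=> s1; have i0 : 'I_N by exact: (Ordinal N_gt0).
have [n _ h] := @Order.TotalTheory.arg_minP _ _ _ i0 xpredT (fun i => `|s - t i|) isT.
by exists n; split => // m _; exact: h.
Qed.

(** Two distinct cells meet only at a midpoint of two nodes, so the overlaps lie in this finite,
    hence null, set. *)
Let mid : set R := [set (t p.1 + t p.2) / 2 | p in [set: 'I_N * 'I_N]].

Lemma voronoi_disjoint s n m : ~ mid s -> voronoi t n s -> voronoi t m s -> n = m.
Proof.
move=> smid [_ hn] [_ hm]; apply/eqP/negPn/negP => nm.
have e : `|s - t n| = `|s - t m|.
  by apply/le_anti; rewrite hn 1?eq_sym // hm.
have tnm : t n != t m by apply: contra_neq nm => /t_inj.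
apply: smid; exists (n, m) => //=.
move/eqP: e; rewrite eqr_norm2 => /orP[/eqP h|/eqP h]; last by lra.
by move/eqP: tnm; case; lra.
Qed.

Lemma Rintegral_sum (I : Type) (r : seq I) (D : set R) (f : I -> R -> R) :
  measurable D -> (forall i, mu.-integrable D (EFin \o f i)) ->
  mu.-integrable D (EFin \o (fun x => \sum_(i <- r) f i x)) /\
  \int[mu]_(x in D) (\sum_(i <- r) f i x) = \sum_(i <- r) \int[mu]_(x in D) f i x.
Proof.
move=> mD fi; elim: r => [|i r [IH1 IH2]].
  split.
    by under [X in EFin \o X]eq_fun do rewrite big_nil; exact: integrable0.
  under eq_Rintegral do rewrite big_nil.
  by rewrite big_nil Rintegral_cst // mul0r.
have e : (fun x => \sum_(j <- i :: r) f j x) = (fun x => f i x + \sum_(j <- r) f j x).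
  by apply/funext => x; rewrite big_cons.
rewrite e; split.
  exact: (@integrableD _ _ _ mu D mD _ _ (fi i) IH1).
by rewrite RintegralD // IH2 big_cons.
Qed.

(** Off the null set [mid] each point of the interval lies in exactly one cell, so the restrictions
    of [f] to the cells add up to [f]. *)
Lemma sum_voronoi (f : R -> R) : mu.-integrable `]-1, 1[ (EFin \o f) ->
  \sum_(n < N) \int[mu]_(s in voronoi t n) f s = \int[mu]_(s in `]-1, 1[) f s.
Proof.
move=> fi; have mD : measurable (`]-1, 1[ : set R) by [].
have resti n : mu.-integrable `]-1, 1[ (EFin \o (f \_ (voronoi t n))).
  rewrite -restrict_EFin; apply/integrable_restrict => //.
    exact: measurable_voronoi.
  apply: integrableS fi => //.
  by apply: measurableI => //; exact: measurable_voronoi.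
have -> : \sum_(n < N) \int[mu]_(s in voronoi t n) f s =
    \sum_(n < N) \int[mu]_(s in `]-1, 1[) (f \_ (voronoi t n)) s.
  apply: eq_bigr => n _; rewrite -Rintegral_mkcondr; congr Rintegral.
  by rewrite setIidr //; exact: voronoi_sub.
have [si <-] := Rintegral_sum _ (index_enum 'I_N) _ _ mD resti.
have midc : countable mid by apply/finite_set_countable/finite_image/finite_finset.
have midm : measurable (mid : set (measurableTypeR R)).
  by apply: countable_measurable => // r; exact: measurable_set1.
have mid0 : mu mid = 0%E by exact: countable_lebesgue_measure0.
rewrite /Rintegral (negligible_integral midm mD si mid0) (negligible_integral midm mD
  fi mid0).
congr fine; apply: eq_integral => s; rewrite inE /= => -[]; rewrite in_itv /= => s1 smid.
have [n vn] := voronoi_cover _ s1; congr EFin.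
rewrite (bigD1 n) //= big1 ?addr0 => [|m mn].
  by rewrite patchE mem_set.
rewrite patchE memNset // => vm; move/eqP: mn; apply; exact: voronoi_disjoint vm vn.
Qed.

Lemma voronoi_density n s : (forall m, -1 <= t m <= 1) -> voronoi t n s ->
  `|s - t n| <= density t.
Proof.
move=> tb [s1 h].
(* [sup] is an upper bound only of a set that is bounded above; the nodes lying in [[-1, 1]] provide
   the bound 2. *)
have le_min u : -1 < u < 1 -> mindist t u <= 2.
  move=> /andP[u1 u2]; pose i0 := Ordinal N_gt0.
  have : mindist t u <= `|u - t i0|.
    by apply: ge_inf; [exists 0 => _ [m _ <-] | exists i0].
  move=> /le_trans; apply; have /andP[t1 t2] := tb i0.
  by rewrite ler_norml; apply/andP; split; lra.
apply: (@le_trans _ _ (mindist t s)).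
  apply: lb_le_inf; first by exists `|s - t n|, n.
  move=> _ [m _ <-]; have [->//|mn] := eqVneq m n; exact: h.
apply: ub_le_sup; last by exists s => //=; rewrite in_itv.
exists 2 => _ [u + <-]; rewrite /= in_itv /=; exact: le_min.
Qed.

End Voronoi.

(** The supremum runs over the open interval; continuity extends the bound to the endpoints, where
    nodes may lie. *)
Lemma Linf_norm_ge (R : realType) (p : {poly R}) (s : R) : -1 <= s <= 1 ->
  `|p.[s]| <= Linf_norm p.
Proof.
have [C C0 bC] := horner_bounded _ p.
have inner (u : R) : -1 < u < 1 -> `|p.[u]| <= Linf_norm p.
  move=> u1; apply: ub_le_sup; last by exists u => //=; rewrite in_itv.
  exists C => _ [v + <-]; rewrite /= in_itv /= => /andP[v1 v2].
  by apply: bC; rewrite !ltW.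
have cp (u : R) : `|p.[v]| @[v --> u] --> `|p.[u]|.
  by apply: cvg_norm; exact: continuous_horner.
move=> /andP[]; rewrite le_eqVlt => /predU1P[<- _|s1].
  have c := cvg_at_right_filter (cp (-1)).
  rewrite -(cvg_lim _ c) //; apply: limr_le; first by apply/cvg_ex; exists `|p.[-1]|.
  by apply: filterS (@near_rightN1 R).
rewrite le_eqVlt => /predU1P[->|s2]; last by apply: inner; rewrite s1.
have c := cvg_at_left_filter (cp 1).
rewrite -(cvg_lim _ c) //; apply: limr_le; first by apply/cvg_ex; exists `|p.[1]|.
by apply: filterS (@near_left1 R).
Qed.

Lemma geometric_sum_le (R : realFieldType) (r : R) n : 0 <= r -> r <= 1 / 2 ->
  \sum_(k < n) r ^+ k.+1 <= 2 * r.
Proof.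
move=> r0 r1; elim: n => [|n IH]; first by rewrite big_ord0 mulr_ge0.
rewrite big_ord_recl /= expr1.
have -> : \sum_(i < n) r ^+ (bump 0 i).+1 = r * \sum_(i < n) r ^+ i.+1.
  by rewrite mulr_sumr; apply: eq_bigr => i _; rewrite -exprS.
have := ler_wpM2l r0 IH; nra.
Qed.

(** * Integration against the Jacobi measure and the Marcinkiewicz-Zygmund inequality *)

Section JacobiFunctional.
Context (R : realType) (alpha beta : R) (phi : nat -> {poly R}).
Local Notation mu := (@lebesgue_measure R).
Local Notation w := (jacobi_w alpha beta).
Local Notation nu := (jacobi_nu alpha beta).
Local Notation D := (`]-1, 1[%classic : set R).
Hypothesis phi_orth : is_orthonormal_jacobi alpha beta phi.

Let mD : measurable (D : set (measurableTypeR R)). Proof. exact: measurable_itv. Qed.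

Let Z := \int[mu]_(s in D) w s.

(** As [0^-1 = 0], a zero [Z] would make [nu] vanish, against the unit norm of [phi 0]. *)
Let Z_neq0 : Z != 0.
Proof.
case: phi_orth => _ [_ /(_ 0 0)]; rewrite eqxx /= => h; apply/negP => /eqP Z0.
move: h; rewrite /L2nu_inner; under eq_Rintegral => s _.
  by rewrite /jacobi_nu -/Z Z0 invr0 !mulr0; over.
by rewrite Rintegral_cst // mul0r => /eqP; rewrite eq_sym oner_eq0.
Qed.

(* Since [fine +oo = 0], a non-integrable weight would give [Z = 0], hence
   [nu = 0], contradicting orthonormality. *)
Lemma integrable_jacobi_w : mu.-integrable D (EFin \o w).
Proof.
apply/integrableP; split; first by apply/measurable_EFinP; exact: measurable_jacobi_w.
under eq_integral do rewrite /= ger0_norm ?jacobi_w_ge0 //.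
rewrite ltey; apply: contra_neq Z_neq0.
by rewrite /Z /Rintegral => ->.
Qed.

Lemma integrable_jacobi_nu : mu.-integrable D (EFin \o nu).
Proof.
have h := integrableZr mD Z^-1 integrable_jacobi_w.
exact: h.
Qed.

Lemma jacobi_nu_ge0 s : 0 <= nu s.
Proof.
by rewrite /jacobi_nu divr_ge0 ?jacobi_w_ge0 // Rintegral_ge0 // => x _;
  exact: jacobi_w_ge0.
Qed.

Definition jacobi_int (p : {poly R}) : R := \int[mu]_(s in D) (p.[s] * nu s).

Lemma integrable_jacobi_int (p : {poly R}) : mu.-integrable D (EFin \o (fun s => p.[s]
  * nu s)).
Proof. exact: (integrable_hornerM _ _ _ integrable_jacobi_nu). Qed.

Lemma jacobi_int_linear : linear_for *%R jacobi_int.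
Proof.
move=> a p q; rewrite /jacobi_int.
rewrite -RintegralZl //; last exact: integrable_jacobi_int.
have i1 : mu.-integrable D (EFin \o (fun s => a * (p.[s] * nu s))).
  exact: (integrableZl mD a (integrable_jacobi_int p)).
rewrite -RintegralD //; last exact: integrable_jacobi_int.
by apply: eq_Rintegral => s _; rewrite hornerD hornerZ mulrDl -mulrA.
Qed.

HB.instance Definition _ :=
  GRing.isLinear.Build R {poly R} R *%R jacobi_int jacobi_int_linear.

Lemma jacobi_int_ge0 (p : {poly R}) :
  (forall s : R, -1 < s < 1 -> 0 <= p.[s]) -> 0 <= jacobi_int p.
Proof.
move=> p0; apply: Rintegral_ge0 => s; rewrite /= in_itv /= => /p0 ps.
by rewrite mulr_ge0 ?jacobi_nu_ge0.
Qed.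

Lemma jacobi_int_ibp (p : {poly R}) : -1 < alpha -> -1 < beta ->
  jacobi_int ((1 - 'X^2) * p^`() +
    ((beta - alpha)%:P - (alpha + beta + 2) *: 'X) * p) = 0.
Proof.
move=> a1 b1; have := jacobi_ibp _ _ _ a1 b1 integrable_jacobi_w p.
set q := _ + _ => h; rewrite /jacobi_int.
rewrite -[RHS](mulr0 Z^-1) -h -RintegralZl //.
  by apply: eq_Rintegral => s _; rewrite /jacobi_nu mulrA mulrC.
exact: (integrable_hornerM _ _ _ integrable_jacobi_w).
Qed.

Lemma jacobi_int_orth i j : jacobi_int (phi i * phi j) = (i == j)%:R.
Proof.
case: phi_orth => _ [_ <-]; apply: eq_Rintegral => s _.
by rewrite hornerM.
Qed.

Lemma jacobi_int1 : jacobi_int 1 = 1.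
Proof.
rewrite /jacobi_int; under eq_Rintegral do rewrite hornerC mul1r /jacobi_nu.
rewrite RintegralZr ?divff //; exact: integrable_jacobi_w.
Qed.

(** The integral of [phi_i^2 nu] is at most the squared supremum because [nu] has mass 1. Hence
    admissible weights are at least 1, and the weighted [l1] tail controls the [l2] tail. *)
Lemma Linf_norm_ge1 i : 1 <= Linf_norm (phi i).
Proof.
have L0 : 0 <= Linf_norm (phi i).
  by apply: le_trans (Linf_norm_ge _ (phi i) 0 _) => //; apply/andP; split; lra.
rewrite -(@ler_pXn2r _ 2) ?nnegrE // expr1n.
have <- : jacobi_int (phi i * phi i) = 1 by rewrite jacobi_int_orth eqxx.
rewrite -[leRHS]mulr1 -jacobi_int1 -linearZ -subr_ge0 -linearB.
apply: jacobi_int_ge0 => s /andP[s1 s2]; rewrite hornerD hornerN hornerM hornerZ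
  hornerC mulr1.
rewrite subr_ge0 -expr2.
rewrite -[leLHS]real_normK ?num_real // lerXn2r ?nnegrE //.
by apply: Linf_norm_ge; rewrite !ltW.
Qed.

Lemma jacobi_int_parseval (M : nat) (v : 'I_M -> R) :
  jacobi_int ((\sum_(i < M) v i *: phi i) * (\sum_(i < M) v i *: phi i)) =
  \sum_(i < M) v i ^+ 2.
Proof.
rewrite mulr_suml linear_sum; apply: eq_bigr => i _ /=.
rewrite mulr_sumr linear_sum (bigD1 i) //= big1 ?addr0 => [|j ji].
  by rewrite -scalerAl -scalerAr 2!linearZ /= jacobi_int_orth eqxx mulr1 expr2.
rewrite -scalerAl -scalerAr 2!linearZ /= jacobi_int_orth.
by rewrite [(_ == _ :> nat)](_ : _ = false) ?mulr0 //; apply/negbTE; rewrite eq_sym.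
Qed.

Section Quadrature.
Context (N : nat) (t : 'I_N -> R).
Hypotheses (N_gt0 : (0 < N)%N) (t_inj : injective t).

Lemma tau_ge0 n : 0 <= tau alpha beta t n.
Proof. by apply: Rintegral_ge0 => s _; exact: jacobi_nu_ge0. Qed.

Lemma sum_tau : \sum_(n < N) tau alpha beta t n = 1.
Proof.
rewrite /tau (sum_voronoi _ _ _ N_gt0 t_inj) ?integrable_jacobi_nu //.
transitivity (jacobi_int 1); last exact: jacobi_int1.
apply: eq_Rintegral => s _.
by rewrite hornerC mul1r.
Qed.

Lemma jacobi_int_le_quadrature (p : {poly R}) (a : 'I_N -> R) :
  (forall n s, voronoi t n s -> p.[s] <= a n) ->
  jacobi_int p <= \sum_(n < N) a n * tau alpha beta t n.
Proof.
move=> pa; rewrite /jacobi_int -(sum_voronoi _ _ _ N_gt0 t_inj);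
  last exact: integrable_jacobi_int.
have Vi n f : mu.-integrable D (EFin \o f) -> mu.-integrable (voronoi t n) (EFin \o f).
  move=> fi; apply: integrableS fi => //; first exact: measurable_voronoi.
  exact: voronoi_sub.
apply: ler_sum => n _; rewrite /tau -RintegralZl; last 2 first.
- exact: measurable_voronoi.
- exact: Vi integrable_jacobi_nu.
apply: le_Rintegral; first exact: measurable_voronoi.
- exact: Vi (integrable_jacobi_int p).
- have mV : measurable (voronoi t n : set (measurableTypeR R)) by exact:
  measurable_voronoi.
  exact: (integrableZl mV (a n) (Vi n _ integrable_jacobi_nu)).
- by move=> s Vs; rewrite ler_wpM2r ?jacobi_nu_ge0 // pa.
Qed.

End Quadrature.

(** On the cell of [t_n], [p(t_n)^2 >= (1 - eps / 2) p(s)^2 - (2 / eps) (p(t_n) - p(s))^2]. By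
    Taylor's formula and the iterated Markov inequality, the last term costs at most another
    [eps / 2] times the integral of [p^2 nu]. *)
Lemma marcinkiewicz_zygmund (eps : R) : -1 < alpha -> -1 < beta -> 0 < eps < 1 ->
  exists2 c : R, 0 < c &
  forall (N : nat) (t : 'I_N -> R) (M : nat),
    (0 < N)%N -> injective t -> (forall n, -1 <= t n <= 1) ->
    density t <= c * (M%:R ^- 2) ->
    forall p : {poly R}, (size p <= M)%N ->
    (1 - eps) * jacobi_int (p * p) <=
    \sum_(n < N) p.[t n] ^+ 2 * tau alpha beta t n.
Proof.
move=> a1 b1 /andP[e0 e1].
have size_phi : forall i, size (phi i) = i.+1 by case: phi_orth.
have [K K0 markov] := pearson_markov_iter R alpha beta jacobi_int phi jacobi_int_ge0
  (fun p => jacobi_int_ibp p a1 b1) size_phi jacobi_int_orth a1 b1.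
(* With this [c], [r <= 2 K c^2 = eps^2 / 8], hence [(2 / eps) (2 r) <= eps / 2]. *)
pose c : R := Num.sqrt (eps ^+ 2 / (16 * K)).
have cE : c ^+ 2 = eps ^+ 2 / (16 * K) by rewrite sqr_sqrtr // divr_ge0 ?sqr_ge0 //
  mulr_ge0 // ltW.
exists c; first by rewrite sqrtr_gt0 divr_gt0 ?exprn_gt0 // mulr_gt0.
move=> N t M N0 ti tb; set h := density t => hc p sp.
have [M0|M0] := posnP M.
  move: sp; rewrite M0 => /size_poly_leq0P ->; rewrite mul0r linear0 mulr0.
  by apply: sumr_ge0 => n _; rewrite mulr_ge0 ?sqr_ge0 ?tau_ge0.
have h0 : 0 <= h.
  have z01 : -1 < (0 : R) < 1 by rewrite ltrN10 ltr01.
  have [n vn] := voronoi_cover _ _ t N0 0 z01.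
  exact: le_trans (voronoi_density _ _ _ N0 _ _ tb vn).
(* The ratio of the geometric series that arises when the powers of [2 h^2] from Taylor meet those
   of [K M^4] from Markov. *)
pose r := 2 * h ^+ 2 * (K * M%:R ^+ 4).
have r0 : 0 <= r by rewrite /r !mulr_ge0 ?sqr_ge0 ?exprn_ge0 // ltW.
have rE : r <= eps ^+ 2 / 8.
  have M1 : 0 < (M%:R : R) by rewrite ltr0n.
  have h1 : h * M%:R ^+ 2 <= c by rewrite -ler_pdivlMr ?exprn_gt0.
  have h2 : (h * M%:R ^+ 2) ^+ 2 <= c ^+ 2.
    by rewrite lerXn2r ?nnegrE ?sqrtr_ge0 // mulr_ge0 ?exprn_ge0 // ltW.
  have -> : eps ^+ 2 / 8 = 2 * K * c ^+ 2 by rewrite cE; field; rewrite gt_eqF.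
  have -> : r = 2 * K * (h * M%:R ^+ 2) ^+ 2 by rewrite /r; ring.
  by rewrite ler_wpM2l // mulr_ge0 // ltW.
have r2 : r <= 1 / 2 by nra.
(* The node has disappeared from this minorant of [p(t_n)^2], so that one polynomial serves every
   cell and can be integrated over the whole interval. *)
pose G : {poly R} := (1 - eps / 2) *: (p * p) - (2 / eps) *:
  \sum_(k < M) (2 * h ^+ 2) ^+ k.+1 *: (p^`N(k.+1) * p^`N(k.+1)).
apply: (@le_trans _ _ (jacobi_int G)); last first.
  apply: jacobi_int_le_quadrature => // n s Vs.
  have sth := voronoi_density _ _ _ N0 _ _ tb Vs.
  have ty := taylor_sqr_le _ M p s (t n) h (leq_trans sp (leqnSn _)) sth.
  rewrite /G hornerD hornerN !hornerZ hornerM horner_sum.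
  have -> : \sum_(i < M) ((2 * h ^+ 2) ^+ i.+1 *: (p^`N(i.+1) * p^`N(i.+1))).[s] =
     \sum_(i < M) (2 * h ^+ 2) ^+ i.+1 * p^`N(i.+1).[s] ^+ 2.
    by apply: eq_bigr => i _; rewrite hornerZ hornerM expr2.
  move: ty; set X := \sum_(i < M) _; set a := p.[t n]; set b := p.[s] => ty.
  have h1 : 2 / eps * (a - b) ^+ 2 <= 2 / eps * X by rewrite ler_wpM2l // divr_ge0 // ltW.
  have h2 : 0 <= (eps / 2) * (b + (2 / eps) * (a - b)) ^+ 2.
    by rewrite mulr_ge0 ?sqr_ge0 // divr_ge0 // ltW.
  have h3 : (eps / 2) * (b + (2 / eps) * (a - b)) ^+ 2 =
     eps / 2 * b ^+ 2 + 2 * b * (a - b) + 2 / eps * (a - b) ^+ 2.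
    by field; rewrite gt_eqF.
  have h4 := sqr_ge0 (a - b).
  by rewrite h3 in h2; nra.
have Ip0 : 0 <= jacobi_int (p * p).
  by apply: jacobi_int_ge0 => s _; rewrite hornerM -expr2 sqr_ge0.
have sumle : \sum_(k < M) jacobi_int ((2 * h ^+ 2) ^+ k.+1 *: (p^`N(k.+1) * p^`N(k.+1)))
   <= 2 * r * jacobi_int (p * p).
  apply: (@le_trans _ _ ((\sum_(k < M) r ^+ k.+1) * jacobi_int (p * p))); last first.
    by rewrite ler_wpM2r // geometric_sum_le.
  rewrite mulr_suml; apply: ler_sum => k _; rewrite linearZ /= /r [in leRHS](exprMn k.+1).
  by rewrite -[leRHS]mulrA ler_wpM2l ?markov // exprn_ge0 // mulr_ge0 ?sqr_ge0.
have -> : jacobi_int G = (1 - eps / 2) * jacobi_int (p * p) - (2 / eps) *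
    \sum_(k < M) jacobi_int ((2 * h ^+ 2) ^+ k.+1 *: (p^`N(k.+1) * p^`N(k.+1))).
  rewrite /G linearB /= -linear_sum; congr (_ - _); exact: linearZ.
set X := \sum_(k < M) _ in sumle *; set J := jacobi_int _ in Ip0 sumle *.
have h1 : 2 / eps * X <= 2 / eps * (2 * r * J) by rewrite ler_wpM2l // divr_ge0 // ltW.
have h2 : 2 / eps * (2 * r * J) <= eps / 2 * J.
  have -> : 2 / eps * (2 * r * J) = ((4 / eps) * r) * J by ring.
  rewrite ler_wpM2r //.
  have -> : eps / 2 = (4 / eps) * (eps ^+ 2 / 8) by field; rewrite gt_eqF.
  by rewrite ler_wpM2l // divr_ge0 // ltW.
lra.
Qed.

End JacobiFunctional.

(** * Real least squares *)

Section LeastSquares.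
Context (R : realFieldType).

Definition sqn (k : nat) (v : 'cV[R]_k) : R := \sum_(i < k) v i ord0 ^+ 2.

Lemma sqn_ge0 k (v : 'cV_k) : 0 <= sqn k v.
Proof. by apply: sumr_ge0 => i _; exact: sqr_ge0. Qed.

Lemma sqn_eq0 k (v : 'cV_k) : sqn k v <= 0 -> v = 0.
Proof.
move=> v0; have /eqP : sqn k v = 0 by apply/le_anti; rewrite v0 sqn_ge0.
rewrite psumr_eq0 => [/allP h|i _]; last exact: sqr_ge0.
apply/colP => i; rewrite mxE; apply/eqP; rewrite -sqrf_eq0.
by apply: h; rewrite mem_index_enum.
Qed.

Lemma sqnE k (v : 'cV_k) : sqn k v = (v^T *m v) ord0 ord0.
Proof. by rewrite mxE; apply: eq_bigr => i _; rewrite mxE expr2. Qed.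

Lemma sqnD k (u v : 'cV_k) : sqn k (u + v) = sqn k u + sqn k v + 2 * (u^T *m v) ord0 ord0.
Proof.
rewrite /sqn mxE mulr_sumr -!big_split; apply: eq_bigr => i _ /=.
by rewrite !mxE; ring.
Qed.

(** Coercivity makes the Gram matrix invertible, and the solution [v0] of the normal equations has a
    residual orthogonal to the range of [A]. This one identity yields minimality, uniqueness and the
    error estimate. *)
Lemma least_squares_pythagoras (N M : nat) (A : 'M[R]_(N, M)) (d : R) (b : 'cV_N) :
  0 < d -> (forall v : 'cV_M, d * sqn M v <= sqn N (A *m v)) ->
  exists v0 : 'cV_M, forall v,
    sqn N (A *m v - b) = sqn N (A *m v0 - b) + sqn N (A *m (v - v0)).
Proof.
move=> d0 coer; pose G := A^T *m A.
have Gu : G \in unitmx.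
  rewrite -row_free_unit; apply: inj_row_free => v vG.
  suff : v^T = 0 by move=> /(congr1 trmx); rewrite trmxK trmx0.
  apply: sqn_eq0; rewrite -(pmulr_rle0 _ d0); apply: le_trans (coer _) _.
  by rewrite sqnE trmx_mul trmxK -mulmxA [A^T *m _]mulmxA mulmxA vG mul0mx mxE.
pose v0 := invmx G *m (A^T *m b); exists v0 => v.
have normal : A^T *m (A *m v0 - b) = 0.
  by rewrite mulmxBr mulmxA -/G mulmxA mulmxV // mul1mx subrr.
have -> : A *m v - b = (A *m v0 - b) + A *m (v - v0).
  by rewrite mulmxBr [RHS]addrC addrA subrK.
rewrite sqnD [X in 2 * X](_ : _ = 0) ?mulr0 ?addr0 //.
rewrite mulmxA -[_ *m A]trmxK trmx_mul trmxK normal trmx0 mul0mx mxE //.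
Qed.

End LeastSquares.

(** * The modulus on [R[i]] *)

Section Cmod.
Context (R : realType).
Implicit Types z u : R[i].

(** Links [cmod], with values in [R], to the norm of [R[i]], whose values are complex; the norm laws
    are transferred along it. *)
Lemma cmodE z : ((cmod z)%:C)%C = `|z|.
Proof. by rewrite normc_def. Qed.

Lemma cmod_ge0 z : 0 <= cmod z.
Proof. exact: sqrtr_ge0. Qed.

Lemma sqr_cmod z : cmod z ^+ 2 = complex.Re z ^+ 2 + complex.Im z ^+ 2.
Proof. by rewrite sqr_sqrtr // addr_ge0 ?sqr_ge0. Qed.

Lemma cmod0 : cmod (0 : R[i]) = 0.
Proof. by rewrite /cmod /= expr0n addr0 sqrtr0. Qed.

Lemma cmodD z u : cmod (z + u) <= cmod z + cmod u.
Proof. by rewrite -lecR rmorphD /= !cmodE ler_normD. Qed.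

Lemma cmodN z : cmod (- z) = cmod z.
Proof. by apply: complexI; rewrite !cmodE normrN. Qed.

Lemma cmodMl (a : R) z : cmod ((a%:C)%C * z) = `|a| * cmod z.
Proof.
apply: complexI; rewrite rmorphM /= !cmodE normrM; congr (_ * _).
by rewrite normc_def /= expr0n addr0 sqrtr_sqr.
Qed.

Lemma cmod_sum I (r : seq I) (P : pred I) (F : I -> R[i]) :
  cmod (\sum_(i <- r | P i) F i) <= \sum_(i <- r | P i) cmod (F i).
Proof.
elim/big_ind2 : _ => [|z a u b za ub|//]; first by rewrite cmod0.
by apply: le_trans (cmodD _ _) _; exact: lerD.
Qed.

Lemma ReD z u : complex.Re (z + u) = complex.Re z + complex.Re u.
Proof. by case: z; case: u. Qed.

Lemma ImD z u : complex.Im (z + u) = complex.Im z + complex.Im u.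
Proof. by case: z; case: u. Qed.

Lemma ReN z : complex.Re (- z) = - complex.Re z. Proof. by case: z. Qed.
Lemma ImN z : complex.Im (- z) = - complex.Im z. Proof. by case: z. Qed.

Lemma Re_realM (a : R) z : @complex.Re R ((a%:C)%C * z) = a * complex.Re z.
Proof. by case: z => b c /=; rewrite mul0r subr0. Qed.

Lemma Im_realM (a : R) z : @complex.Im R ((a%:C)%C * z) = a * complex.Im z.
Proof. by case: z => b c /=; rewrite mul0r addr0. Qed.

Lemma Re_sum I (r : seq I) (P : pred I) (F : I -> R[i]) :
  complex.Re (\sum_(i <- r | P i) F i) = \sum_(i <- r | P i) complex.Re (F i).
Proof. by apply: (big_morph _ ReD). Qed.

Lemma Im_sum I (r : seq I) (P : pred I) (F : I -> R[i]) :
  complex.Im (\sum_(i <- r | P i) F i) = \sum_(i <- r | P i) complex.Im (F i).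
Proof. by apply: (big_morph _ ImD). Qed.

Lemma Re_le_cmod z : `|complex.Re z| <= cmod z.
Proof. by rewrite -sqrtr_sqr ler_sqrt ?addr_ge0 ?sqr_ge0 // lerDl sqr_ge0. Qed.

Lemma Im_le_cmod z : `|complex.Im z| <= cmod z.
Proof. by rewrite -sqrtr_sqr ler_sqrt ?addr_ge0 ?sqr_ge0 // lerDr sqr_ge0. Qed.

End Cmod.

(** * Real series *)

Section Series.
Context (R : realType).

(** From index [M] on, the partial sums of the two series differ by the constant head. *)
Lemma series_head_tail (a : nat -> R) (M : nat) :
  cvgn (series (fun i => if (i < M)%N then 0 else a i)) ->
  limn (series a) = \sum_(i < M) a i +
    limn (series (fun i => if (i < M)%N then 0 else a i)).
Proof.
move=> ca; set b := fun i : nat => _ in ca *.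
apply: cvg_lim => //.
have e : forall n, (M <= n)%N -> series a n = \sum_(i < M) a i + series b n.
  move=> n Mn; rewrite !seriesEord /= -!(big_mkord xpredT).
  rewrite (big_cat_nat (n := M)) //= [X in _ = _ + X](big_cat_nat (n := M)) //=.
  rewrite [X in _ = _ + (X + _)]big_nat_cond [X in _ = _ + (X + _)]big1 ?add0r.
    congr (_ + _); rewrite big_nat_cond [RHS]big_nat_cond.
    apply: eq_bigr => i /andP[/andP[Mi _] _].
    by rewrite /b ltnNge Mi.
  by move=> i /andP[/andP[_ iM] _]; rewrite /b iM.
apply: (@cvg_trans _ ((fun n => \sum_(i < M) a i + series b n) @ \oo)).
  by apply: near_eq_cvg; exists M => // n /= Mn; rewrite e.
by apply: cvgD; [exact: cvg_cst | exact: ca].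
Qed.

Lemma sum_le_lim_series (a : nat -> R) n : (forall i, 0 <= a i) ->
  cvgn (series a) -> \sum_(i < n) a i <= limn (series a).
Proof.
move=> a0 ca; have := nondecreasing_cvgn_le _ ca n.
rewrite seriesEord; apply; apply/nondecreasing_seqP => k.
by rewrite /= big_ord_recr /= lerDl.
Qed.

(** Bounded partial sums of nonnegative terms converge, so [limn] is the true sum here and not a
    default value. *)
Lemma lim_series_le_bound (a : nat -> R) (B : R) : (forall i, 0 <= a i) ->
  (forall n, \sum_(i < n) a i <= B) -> limn (series a) <= B.
Proof.
move=> a0 aB; have nd : nondecreasing_seq (series a).
  apply/nondecreasing_seqP => k.
  by rewrite !seriesEord /= big_ord_recr /= lerDl.
apply: limr_le; last by apply: nearW => n; rewrite seriesEord; exact: aB.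
apply: nondecreasing_is_cvgn => //; exists B => _ [n _ <-].
by rewrite seriesEord; exact: aB.
Qed.

Lemma cvg_series_le (a b : nat -> R) : (forall i, `|a i| <= b i) ->
  cvgn (series b) -> cvgn (series a).
Proof.
move=> ab cb; apply: normed_cvg; apply: series_le_cvg cb => // i; first exact: normr_ge0.
exact: le_trans (normr_ge0 _) (ab i).
Qed.

(** Fitted to [fval], whose real and imaginary parts are separate limits: a modulus bound on partial
    sums passes to the limit. *)
Lemma cmod_lim_series_le (a b : nat -> R) (B : R) : 0 <= B ->
  cvgn (series a) -> cvgn (series b) ->
  (forall n, (\sum_(i < n) a i) ^+ 2 + (\sum_(i < n) b i) ^+ 2 <= B ^+ 2) ->
  cmod (Complex (limn (series a)) (limn (series b))) <= B.
Proof.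
move=> B0 ca cb h; rewrite -(@ler_pXn2r _ 2) ?nnegrE ?cmod_ge0 // sqr_cmod /=.
have c : (fun n => series a n ^+ 2 + series b n ^+ 2) @ \oo -->
    limn (series a) ^+ 2 + limn (series b) ^+ 2.
  by apply: cvgD; rewrite !expr2; apply: cvgM.
rewrite -(cvg_lim _ c) //; apply: limr_le.
  by apply/cvg_ex; eexists; exact: c.
by apply: nearW => n; rewrite !seriesEord; exact: h.
Qed.

End Series.

(** * Recovery of the coefficients from samples *)

Section Recovery.
Context (R : realType) (alpha beta : R) (phi : nat -> {poly R}).
Context (N M : nat) (t : 'I_N -> R).
Hypothesis phi_orth : is_orthonormal_jacobi alpha beta phi.
Hypotheses (N_gt0 : (0 < N)%N) (t_inj : injective t) (t_bnd : forall n, -1 <= t n <= 1).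
Variable eps : R.
Hypothesis eps_lt1 : eps < 1.
Hypothesis quadrature : forall p : {poly R}, (size p <= M)%N ->
  (1 - eps) * jacobi_int R alpha beta (p * p) <=
  \sum_(n < N) p.[t n] ^+ 2 * tau alpha beta t n.

Local Notation tau := (tau alpha beta t).

(** The matrix of [UPM]; its entries are real, so real and imaginary parts decouple. *)
Let samp : 'M[R]_(N, M) := \matrix_(n, i) (Num.sqrt (tau n) * (phi i).[t n]).

Let re k (z : 'cV[R[i]]_k) : 'cV[R]_k := map_mx (@complex.Re R) z.
Let im k (z : 'cV[R[i]]_k) : 'cV[R]_k := map_mx (@complex.Im R) z.

Lemma samp_coercive (v : 'cV[R]_M) : (1 - eps) * sqn R M v <= sqn R N (samp *m v).
Proof.
pose p := \sum_(i < M) v i ord0 *: phi i.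
have size_phi i : size (phi i) = i.+1 by case: phi_orth.
have sp : (size p <= M)%N.
  apply: (leq_trans (size_sum _ _ _)); apply/bigmax_leqP => i _.
  by rewrite (leq_trans (size_scale_leq _ _)) // size_phi.
have -> : sqn R M v = jacobi_int R alpha beta (p * p).
  by rewrite (jacobi_int_parseval R alpha beta phi phi_orth).
apply: le_trans (quadrature p sp) _; rewrite le_eqVlt; apply/predU1P; left.
apply: eq_bigr => n _.
have -> : (samp *m v) n ord0 = Num.sqrt (tau n) * p.[t n].
  rewrite mxE /p horner_sum mulr_sumr; apply: eq_bigr => i _.
  by rewrite mxE hornerZ -mulrA [v i _ * _]mulrC.
by rewrite exprMn sqr_sqrtr 1?mulrC // (tau_ge0 R alpha beta).
Qed.

Lemma UPM_complex (z : 'cV[R[i]]_M) n :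
  complex.Re (UPM alpha beta phi t z n) = (samp *m re M z) n ord0 /\
  complex.Im (UPM alpha beta phi t z n) = (samp *m im M z) n ord0.
Proof.
rewrite /UPM Re_sum Im_sum !mxE; split; apply: eq_bigr => i _.
  by rewrite /samp /re !mxE; case: (z i ord0) => c d /=; rewrite mul0r subr0.
by rewrite /samp /im !mxE; case: (z i ord0) => c d /=; rewrite mul0r addr0.
Qed.

(** The minimiser is assembled from those of the real and the imaginary problem. The last clause
    bounds its distance to any [z] by the residual of [z] alone, ready for [z = P_M x]. *)
Lemma complex_least_squares (y : 'I_N -> R[i]) :
  let res := fun z : 'cV[R[i]]_M => normN (fun n => UPM alpha beta phi t z n - y n) in
  exists zc : 'cV[R[i]]_M,
    (forall z : 'cV[R[i]]_M, res zc <= res z) /\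
    (forall xc : 'cV[R[i]]_M, (forall z : 'cV[R[i]]_M, res xc <= res z) -> xc = zc /\
      forall z : 'cV[R[i]]_M, (1 - eps) * \sum_(i < M) cmod (z i ord0 - xc i ord0) ^+ 2
        <= res z ^+ 2).
Proof.
move=> res; have e1 : 0 < 1 - eps by rewrite subr_gt0.
have [a ha] := least_squares_pythagoras R N M samp (1 - eps) (\col_n complex.Re (y n))
  e1 samp_coercive.
have [b hb] := least_squares_pythagoras R N M samp (1 - eps) (\col_n complex.Im (y n))
  e1 samp_coercive.
pose zc : 'cV[R[i]]_M := \col_i Complex (a i ord0) (b i ord0).
have rezc : re M zc = a by apply/colP => i; rewrite !mxE.
have imzc : im M zc = b by apply/colP => i; rewrite !mxE.
have resE z : res z ^+ 2 = sqn R N (samp *m re M z - \col_n complex.Re (y n)) +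
    sqn R N (samp *m im M z - \col_n complex.Im (y n)).
  rewrite /res /normN sqr_sqrtr; last by apply: sumr_ge0 => n _; exact: sqr_ge0.
  rewrite /sqn -big_split; apply: eq_bigr => n _ /=.
  rewrite sqr_cmod ReD ImD ReN ImN; have [-> ->] := UPM_complex z n.
  have subE (u v : 'cV[R]_N) : (u - v) n ord0 = u n ord0 - v n ord0 by rewrite !mxE.
  by rewrite !subE; congr ((_ - _) ^+ 2 + (_ - _) ^+ 2); rewrite mxE.
have pyth z : res z ^+ 2 = res zc ^+ 2 + (sqn R N (samp *m (re M z - a)) + sqn R N
  (samp *m (im M z - b))).
  by rewrite !resE rezc imzc ha hb; ring.
have res_ge0 z : 0 <= res z by exact: sqrtr_ge0.
exists zc; split=> [z|xc xcmin].
  rewrite -(@ler_pXn2r _ 2) ?nnegrE // (pyth z) lerDl.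
  by rewrite addr_ge0 ?sqn_ge0.
have xcE : xc = zc.
  have h : res xc ^+ 2 <= res zc ^+ 2 by rewrite lerXn2r ?nnegrE.
  have h1 := samp_coercive (re M xc - a); have h2 := samp_coercive (im M xc - b).
  rewrite (pyth xc) gerDl in h.
  have s1 := sqn_ge0 R M (re M xc - a); have s2 := sqn_ge0 R M (im M xc - b).
  have := sqn_eq0 R M (re M xc - a) (ltac:(nra)) => /eqP; rewrite subr_eq0 => /eqP ea.
  have := sqn_eq0 R M (im M xc - b) (ltac:(nra)) => /eqP; rewrite subr_eq0 => /eqP eb.
  apply/colP => i; rewrite mxE -ea -eb !mxE; by case: (xc i ord0).
split=> // z; rewrite xcE (pyth z).
apply: (@le_trans _ _ (sqn R N (samp *m (re M z - a)) + sqn R N (samp *m (im M z - b)))).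
  apply: le_trans (lerD (samp_coercive _) (samp_coercive _)).
  rewrite -mulrDr ler_wpM2l ?(ltW e1) // /sqn -big_split le_eqVlt; apply/predU1P; left.
  by apply: eq_bigr => i _ /=; rewrite sqr_cmod ReD ImD ReN ImN !mxE.
by rewrite lerDr sqr_ge0.
Qed.

Variables (x : nat -> R[i]) (w : nat -> R).
Hypothesis w_Linf : forall i, Linf_norm (phi i) <= w i.
Hypothesis w_cvg : cvgn (series (fun i => w i * cmod (tailM M x i))).

Let T := wl1norm w (tailM M x).

Lemma weight_ge1 i : 1 <= w i.
Proof. exact: le_trans (Linf_norm_ge1 R alpha beta phi phi_orth i) (w_Linf i). Qed.

Let w_ge0 i : 0 <= w i.
Proof. exact: le_trans (weight_ge1 i). Qed.

Lemma sum_tail_le n : \sum_(i < n) w i * cmod (tailM M x i) <= T.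
Proof. by apply: (sum_le_lim_series R (fun i => w i * cmod (tailM M x i))) => // i;
  rewrite mulr_ge0 ?cmod_ge0. Qed.

Lemma tail_ge0 : 0 <= T.
Proof. by have := sum_tail_le 0; rewrite big_ord0. Qed.

Lemma fval_tail_le (s : R) : -1 <= s <= 1 ->
  cmod (fval phi x s - \sum_(i < M) ((phi i).[s]%:C)%C * x i) <= T.
Proof.
move=> s1; pose a i := complex.Re (tailM M x i) * (phi i).[s].
pose b i := complex.Im (tailM M x i) * (phi i).[s].
have le_w i : `|(phi i).[s]| <= w i by exact: le_trans (Linf_norm_ge _ _ _ s1) (w_Linf i).
have ca : cvgn (series a).
  apply: (cvg_series_le _ _ _ _ w_cvg) => i; rewrite normrM mulrC ler_pM //;
    exact: Re_le_cmod.
have cb : cvgn (series b).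
  apply: (cvg_series_le _ _ _ _ w_cvg) => i; rewrite normrM mulrC ler_pM //;
    exact: Im_le_cmod.
have aE : a = (fun i => if (i < M)%N then 0 else complex.Re (x i) * (phi i).[s]).
  by apply/funext => i; rewrite /a /tailM; case: ifP => //= _; rewrite mul0r.
have bE : b = (fun i => if (i < M)%N then 0 else complex.Im (x i) * (phi i).[s]).
  by apply/funext => i; rewrite /b /tailM; case: ifP => //= _; rewrite mul0r.
have -> : fval phi x s - \sum_(i < M) ((phi i).[s]%:C)%C * x i =
    Complex (limn (series a)) (limn (series b)).
  rewrite /fval (series_head_tail R (fun i => complex.Re (x i) * (phi i).[s]) M) -?aE //.
  rewrite (series_head_tail R (fun i => complex.Im (x i) * (phi i).[s]) M) -?bE //.
  apply/eqP; rewrite eq_complex ReD ImD ReN ImN Re_sum Im_sum /=.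
  apply/andP; split; apply/eqP.
    rewrite addrAC [X in X - _](_ : _ = \sum_(i < M) complex.Re ((phi i).[s]%:C%C * x
      i)) ?subrr ?add0r //.
    by apply: eq_bigr => i _; rewrite Re_realM mulrC.
  rewrite addrAC [X in X - _](_ : _ = \sum_(i < M) complex.Im ((phi i).[s]%:C%C * x i))
    ?subrr ?add0r //.
  by apply: eq_bigr => i _; rewrite Im_realM mulrC.
apply: cmod_lim_series_le => //; first exact: tail_ge0.
(* Real and imaginary partial sums are recombined into the complex sum [u] before the triangle
   inequality; separate bounds would lose a factor [sqrt 2]. *)
move=> n; pose u := \sum_(i < n) ((phi i).[s]%:C)%C * tailM M x i.
have -> : \sum_(i < n) a i = complex.Re u.
  by rewrite Re_sum; apply: eq_bigr => i _; rewrite Re_realM mulrC.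
have -> : \sum_(i < n) b i = complex.Im u.
  by rewrite Im_sum; apply: eq_bigr => i _; rewrite Im_realM mulrC.
rewrite -sqr_cmod lerXn2r ?nnegrE ?cmod_ge0 ?tail_ge0 //.
apply: le_trans (cmod_sum _ _ _ _ _) _; apply: le_trans (sum_tail_le n).
by apply: ler_sum => i _; rewrite cmodMl ler_wpM2r ?cmod_ge0.
Qed.

(** The error splits into a head, estimated by comparison with [P_M x], and the tail of [x], whose
    [l2] norm is at most [T] since the weights are at least 1. *)
Lemma recovery_bound (eta : R) (e : 'I_N -> R[i]) (xc : 'cV[R[i]]_M) :
  (forall n, cmod (e n) <= eta) ->
  let y := fun n : 'I_N => ((Num.sqrt (tau n))%:C * (fval phi x (t n) + e n))%C in
  let res := fun z : 'cV[R[i]]_M => normN (fun n => UPM alpha beta phi t z n - y n) in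
  (forall z, res xc <= res z) ->
  l2norm (fun i => x i - extM xc i) <=
    (1 + (Num.sqrt (1 - eps))^-1) * T + (Num.sqrt (1 - eps))^-1 * eta.
Proof.
move=> eeta y res xcmin.
have eta0 : 0 <= eta by exact: le_trans (cmod_ge0 _ _) (eeta (Ordinal N_gt0)).
have T0 := tail_ge0.
have e1 : 0 < 1 - eps by rewrite subr_gt0.
have [zc [_ uq]] := complex_least_squares y.
have [_ err] := uq xc xcmin.
pose z : 'cV[R[i]]_M := \col_i x i.
(* Each entry of the residual at [P_M x] is at most [sqrt (tau n)] times truncation error plus
   noise, and the [tau n] add up to 1. *)
have resz : res z ^+ 2 <= (T + eta) ^+ 2.
  rewrite /res /normN sqr_sqrtr; last by apply: sumr_ge0 => n _; exact: sqr_ge0.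
  rewrite -[leRHS]mulr1 -(sum_tau R alpha beta phi phi_orth N t N_gt0 t_inj) mulr_sumr.
  apply: ler_sum => n _.
  have -> : UPM alpha beta phi t z n - y n = ((Num.sqrt (tau n))%:C)%C *
      - (fval phi x (t n) - \sum_(i < M) ((phi i).[t n]%:C)%C * x i + e n).
    have -> : UPM alpha beta phi t z n =
        ((Num.sqrt (tau n))%:C)%C * \sum_(i < M) ((phi i).[t n]%:C)%C * x i.
      by rewrite mulr_sumr; apply: eq_bigr => i _; rewrite mxE rmorphM /= mulrA.
    by rewrite /y; ring.
  rewrite cmodMl cmodN exprMn real_normK ?num_real //
    sqr_sqrtr ?(tau_ge0 R alpha beta) //.
  rewrite mulrC ler_wpM2r ?(tau_ge0 R alpha beta) //
    lerXn2r ?nnegrE ?cmod_ge0 ?addr_ge0 //.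
  by apply: le_trans (cmodD _ _ _) _; apply: lerD => //; exact: fval_tail_le.
set S := \sum_(i < M) cmod (z i ord0 - xc i ord0) ^+ 2 in err.
pose q := (Num.sqrt (1 - eps))^-1.
have q0 : 0 <= q by rewrite invr_ge0 sqrtr_ge0.
have q2 : q ^+ 2 * (1 - eps) = 1.
  by rewrite exprVn sqr_sqrtr ?mulVf ?gt_eqF // ltW.
have Sle : \sum_(i < M) cmod (x i - extM xc i) ^+ 2 <= (q * (T + eta)) ^+ 2.
  have -> : \sum_(i < M) cmod (x i - extM xc i) ^+ 2 = \sum_(i < M) cmod (z i ord0 - xc
    i ord0) ^+ 2.
    apply: eq_bigr => i _; rewrite mxE /extM insubT //= => iM.
    by congr (cmod (_ - xc _ _) ^+ 2); exact: val_inj.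
  have := le_trans (err z) resz => h.
  rewrite -[leLHS]mul1r -q2 exprMn -mulrA ler_wpM2l ?sqr_ge0 //.
(* Bounding every partial sum suffices; for [n < M] the head sum is completed to all [M] terms. *)
have partial n : \sum_(i < n) cmod (x i - extM xc i) ^+ 2 <= (q * (T + eta) + T) ^+ 2.
  pose c i := cmod (tailM M x i).
  have c0 i : 0 <= c i by exact: cmod_ge0.
  have tail2 k : \sum_(i < k) c i ^+ 2 <= (\sum_(i < k) c i) ^+ 2.
    elim: k => [|k IH]; first by rewrite !big_ord0 expr0n.
    have s0 : 0 <= \sum_(i < k) c i by apply: sumr_ge0.
    by rewrite !big_ord_recr /=; have := c0 k; nra.
  have tailT k : \sum_(i < k) c i <= T.
    apply: le_trans (sum_tail_le k); apply: ler_sum => i _.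
    by rewrite ler_peMl ?weight_ge1.
  have tsq : \sum_(i < n) c i ^+ 2 <= T ^+ 2.
    by apply: le_trans (tail2 n) _; rewrite lerXn2r ?nnegrE ?sumr_ge0.
  have split : \sum_(i < n) cmod (x i - extM xc i) ^+ 2 <=
      \sum_(i < M) cmod (x i - extM xc i) ^+ 2 + \sum_(i < n) c i ^+ 2.
    have term i : cmod (x i - extM xc i) ^+ 2 =
        (if (i < M)%N then cmod (x i - extM xc i) ^+ 2 else 0) + c i ^+ 2.
      rewrite /c /tailM; case: ifP => iM; first by rewrite cmod0 expr0n addr0.
      by rewrite /extM insubF //= subr0 add0r.
    under eq_bigr do rewrite term; rewrite big_split lerD2r -big_mkcond /=.
    pose f i := cmod (x i - extM xc i) ^+ 2.
    have [Mn|/ltnW nM] := leqP M n; first by rewrite -(big_ord_widen n f Mn).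
    rewrite (eq_bigl xpredT) => [|i]; last by rewrite (leq_trans (ltn_ord i)).
    rewrite (big_ord_widen M f nM) big_mkcond; apply: ler_sum => i _.
    by case: ifP => // _; exact: sqr_ge0.
  have qT : 0 <= q * (T + eta) by rewrite mulr_ge0 ?addr_ge0.
  by nra.
have -> : (1 + (Num.sqrt (1 - eps))^-1) * T + (Num.sqrt (1 - eps))^-1 * eta = q * (T +
  eta) + T.
  by rewrite -/q; ring.
have B0 : 0 <= q * (T + eta) + T by rewrite addr_ge0 // mulr_ge0 ?addr_ge0.
rewrite /l2norm -[leRHS]ger0_norm // -sqrtr_sqr ler_wsqrtr //.
by apply: lim_series_le_bound => // i; exact: sqr_ge0.
Qed.

End Recovery.

Theorem theorem7p2 (R : realType) (alpha beta : R)
  (phi : nat -> {poly R}) :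
  -1 < alpha -> -1 < beta ->
  is_orthonormal_jacobi alpha beta phi ->
  forall eps : R, 0 < eps < 1 ->
  exists c : R, 0 < c /\
  forall (N : nat) (t : 'I_N -> R) (M : nat),
    (0 < N)%N -> injective t -> (forall n, -1 <= t n <= 1) ->
    density t <= c * (M%:R ^- 2) ->
    forall (x : nat -> R[i]) (eta : R) (e : 'I_N -> R[i]),
      (forall n, cmod (e n) <= eta) ->
      let y := fun n : 'I_N =>
        ((Num.sqrt (tau alpha beta t n))%:C * (fval phi x (t n) + e n))%C in
      let res := fun z : 'cV[R[i]]_M => normN (fun n => UPM alpha beta phi t z n - y n) in
      (exists! xc : 'cV[R[i]]_M, forall z, res xc <= res z) /\
      (forall xc : 'cV[R[i]]_M, (forall z, res xc <= res z) ->
       forall w : nat -> R,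
         (forall i, Linf_norm (phi i) <= w i) ->
         cvgn (series (fun i => w i * cmod (tailM M x i))) ->
         l2norm (fun i => x i - extM xc i) <=
           (1 + (Num.sqrt (1 - eps))^-1) * wl1norm w (tailM M x)
           + (Num.sqrt (1 - eps))^-1 * eta).
Proof.
move=> a1 b1 orth eps eps01.
have [c c0 mz] := marcinkiewicz_zygmund R alpha beta phi orth eps a1 b1 eps01.
have /andP[_ eps1] := eps01.
exists c; split => // N t M N0 ti tb hd x eta e eeta y res.
have quad := mz N t M N0 ti tb hd.
split.
  have [zc [zcmin uq]] := complex_least_squares R alpha beta phi N M t orth eps eps1
    quad y.
  by exists zc; split => // xc xcmin; have [->] := uq xc xcmin.
move=> xc xcmin w wL wc.
exact: (recovery_bound R alpha beta phi N M t orth N0 ti tb eps eps1 quad x w wL wc eta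
  e xc eeta xcmin).
Qed.
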